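(* Assume that $0<a<b<\infty$ and $y>0$ are real numbers. Let $$c=\frac{b-a}{b-a+y\ln\left(\frac{b}{a}\right)},\quad \alpha=\ln c+1,\quad \beta=-c.$$ Then $$\frac{B(b,y)}{B(a,y)}\geq e^{(\alpha+\beta)(b-a)}\left(\frac{b}{a}\right)^{y\beta-1}\left(\frac{b+y}{a+y}\right).$$
   Context: For real $x,y>0$, $B(x,y)=\int_0^1 t^{x-1}(1-t)^{y-1}\,dt$ denotes the (Euler) beta function. *)

(* Defs.v *)
From mathcomp Require Import all_boot all_order all_algebra.
From mathcomp Require Import all_classical all_reals all_analysis.

Set Implicit Arguments.
Unset Strict Implicit.
Unset Printing Implicit Defensive.

Import Order.TTheory GRing.Theory Num.Theory.
Local Open Scope classical_set_scope.
Local Open Scope ring_scope.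

(* The library's [beta_fun] takes natural arguments only. The integral here is
   over the open interval, where the integrand is defined for all real
   exponents; for 0 < x and 0 < y it is finite, and it agrees with the
   (possibly improper) Riemann integral since the integrand is nonnegative. *)
Definition euler_beta (R : realType) (x y : R) : R :=
  (\int[@lebesgue_measure R]_(t in `]0, 1[)
     (t `^ (x - 1) * (1 - t) `^ (y - 1)))%R.

(* Main.v *)
Require Import Defs.
From mathcomp Require Import all_boot all_order all_algebra.
From mathcomp Require Import all_classical all_reals all_analysis.
From mathcomp Require Import measurable_realfun ring lra.

Set Implicit Arguments.
Unset Strict Implicit.
Unset Printing Implicit Defensive.

Import Order.TTheory GRing.Theory Num.Theory.
Import numFieldNormedType.Exports.
Local Open Scope classical_set_scope.
Local Open Scope ring_scope.

(* The right-hand side equals [c^(b-a) (a/b) (b+y)/(a+y)], and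
   [x B(x,y) = (x+y) B(x+1,y)], so the claim is
   [B(b+1,y)/B(a+1,y) >= c^(b-a)]. Since [B(.,y)] is log-convex, the slope of
   [ln B(.,y)] to the right of [s+1] is at least its slope [ln (s/(s+y))] over
   [s, s+1]. Integrating this over [a <= s <= b], after bounding
   [ln (s/(s+y))] below by its tangent [1 + ln c - c(1 + y/s)], gives
   [(b-a) ln c]. *)

(** * Exhaustion of the open unit interval by compact intervals *)

(** The offset 3 keeps the left end strictly below 1/2, so that even the interval of index 0, the
    middle third, has positive length. *)
Definition inner_itv (R : realType) (n : nat) : set R :=
  `[n.+3%:R^-1, 1 - n.+3%:R^-1].

Section InnerIntervals.
Variable R : realType.
Implicit Types (f F : R -> R) (t : R) (n : nat).

Local Notation mu := (@lebesgue_measure R).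

Lemma inner_itv_ends n : 0 < n.+3%:R^-1 :> R /\ n.+3%:R^-1 < 1 / 2 :> R.
Proof.
rewrite invr_gt0 ltr0n; split=> //.
by rewrite div1r ltf_pV2 ?posrE ?ltr0n// ltr_nat.
Qed.

Lemma inner_itvW n t : inner_itv n t -> 0 < t < 1.
Proof.
rewrite /inner_itv /= in_itv /= => /andP[h1 h2].
have [] := inner_itv_ends n; move: h1 h2; set e := _^-1 => *.
by apply/andP; split; lra.
Qed.

Lemma measurable_inner_itv n : measurable (@inner_itv R n).
Proof. exact: measurable_itv. Qed.

Lemma nondecreasing_inner_itv : nondecreasing_seq (@inner_itv R).
Proof.
move=> m n mn; rewrite subsetEset /inner_itv => t /=.
rewrite !in_itv /= => /andP[h1 h2].
have h : n.+3%:R^-1 <= m.+3%:R^-1 :> R.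
  by rewrite lef_pV2 ?posrE ?ltr0n// ler_nat !ltnS.
move: h h1 h2; set e := n.+3%:R^-1; set e' := m.+3%:R^-1 => *.
apply/andP; split; lra.
Qed.

Lemma bigcup_inner_itv : \bigcup_n (@inner_itv R n) = `]0, 1[%classic.
Proof.
apply/seteqP; split=> [t [n _ /inner_itvW]|t]; first by rewrite /= in_itv.
rewrite /= in_itv /= => /andP[t0 t1].
pose m := Num.min t (1 - t).
have m0 : 0 < m by rewrite /m lt_min t0 subr_gt0.
exists (Num.Def.archi_bound m^-1) => //; rewrite /inner_itv /= in_itv /=.
set n := Num.Def.archi_bound _.
have hn : n.+3%:R^-1 <= m.
  rewrite invf_ple ?posrE ?ltr0n//.
  apply: (le_trans (ltW (archi_boundP _))); first by rewrite invr_ge0 ltW.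
  by rewrite ler_nat -addn3 leq_addr.
move: hn; rewrite /m le_min => /andP[]; set e := n.+3%:R^-1 => *.
by apply/andP; split; lra.
Qed.

(** The interval is compact inside ]0, 1[, so the fundamental theorem of calculus applies even if
    [f] blows up at 0 or 1. *)
Lemma integral_inner_itv f F n :
    (forall t, 0 < t < 1 -> is_derive t 1 F (f t)) ->
    (forall t, 0 < t < 1 -> {for t, continuous f}) ->
  (\int[mu]_(t in inner_itv n) (f t)%:E =
   (F (1 - n.+3%:R^-1) - F n.+3%:R^-1)%:E)%E.
Proof.
move=> dF cf; have [e0 e1] := inner_itv_ends n.
rewrite /inner_itv; set e := _^-1 in e0 e1 *.
have cF t : 0 < t < 1 -> {for t, continuous F}.
  move=> t01; apply: differentiable_continuous; apply/derivable1_diffP.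
  exact: (@ex_derive _ _ _ _ _ _ _ (dF _ t01)).
rewrite EFinB; apply: continuous_FTC2; first lra.
- apply: continuous_in_subspaceT => t; rewrite inE.
  by move/(@inner_itvW n); exact: cf.
- split.
  + move=> t; rewrite in_itv /= => /andP[h1 h2].
    have t01 : 0 < t < 1 by apply/andP; split; lra.
    exact: (@ex_derive _ _ _ _ _ _ _ (dF _ t01)).
  + apply: cvg_at_right_filter; apply: cF; apply/andP; split; lra.
  + apply: cvg_at_left_filter; apply: cF; apply/andP; split; lra.
- move=> t; rewrite in_itv /= => /andP[h1 h2].
  have t01 : 0 < t < 1 by apply/andP; split; lra.
  by rewrite derive1E (@derive_val _ _ _ _ _ _ _ (dF _ t01)).
Qed.

(** Monotone convergence. The limit is taken in the extended reals, so it can also serve to prove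
    integrability. *)
Lemma cvg_integral_inner_itv f :
    measurable_fun setT f -> (forall t, 0 < t < 1 -> 0 <= f t) ->
  (\int[mu]_(t in inner_itv n) (f t)%:E)%E @[n --> \oo] -->
  (\int[mu]_(t in `]0%R, 1%R[) (f t)%:E)%E.
Proof.
move=> mf f0; rewrite -bigcup_inner_itv.
apply: ge0_nondecreasing_set_cvg_integral.
- exact: nondecreasing_inner_itv.
- exact: measurable_inner_itv.
- by move=> n; apply/measurable_EFinP; exact: measurable_funTS.
- by move=> n t /inner_itvW t01; rewrite lee_fin f0.
Qed.

End InnerIntervals.

(** * The beta integrand: derivative, continuity, integrability *)

Section BetaIntegrand.
Variable R : realType.
Implicit Types x y t : R.

Local Notation mu := (@lebesgue_measure R).

Lemma is_derive_powR_onem y t : t < 1 ->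
  is_derive t 1 (fun t => (1 - t) `^ y) (- (y * (1 - t) `^ (y - 1))).
Proof.
rewrite -subr_gt0 => t1.
have d2 : is_derive t 1 (fun t : R => 1 - t) (0 - 1).
  exact: (@is_deriveB R R R (cst 1) id t 1 0 1
    (is_derive_cst _ _ _) (is_derive_id _ _)).
have := @is_derive1_comp R (@powR R ^~ y) (fun t : R => 1 - t) t _ _
  (is_derive1_powR y t1) d2.
by rewrite sub0r mulrN1.
Qed.

Lemma is_derive_beta_primitive x y t : 0 < t < 1 ->
  is_derive t 1 (fun t => t `^ x * (1 - t) `^ y)
   (x * (t `^ (x - 1) * (1 - t) `^ y) - y * (t `^ x * (1 - t) `^ (y - 1))).
Proof.
move=> /andP[t0 t1].
apply: (is_derive_eq
  (is_deriveM (is_derive1_powR x t0) (is_derive_powR_onem y t1))).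
rewrite /= /GRing.scale /=; ring.
Qed.

Definition beta_integrand x y t := t `^ (x - 1) * (1 - t) `^ (y - 1).

Lemma continuous_beta_integrand x y t : 0 < t < 1 ->
  {for t, continuous (beta_integrand x y)}.
Proof.
move=> t01; apply: differentiable_continuous; apply/derivable1_diffP.
(* The integrand is itself such a primitive, with exponents [x - 1] and [y - 1]. *)
exact: (@ex_derive _ _ _ _ _ _ _ (is_derive_beta_primitive _ _ t01)).
Qed.

Lemma measurable_beta_integrand x y :
  measurable_fun setT (beta_integrand x y).
Proof.
apply: measurable_funM; first exact: measurable_powR.
apply: (@measurableT_comp _ _ _ _ _ _ (@powR R ^~ (y - 1))).
  exact: measurable_powR.
exact: measurable_funB.
Qed.

Lemma beta_integrand_gt0 x y t : 0 < t < 1 -> 0 < beta_integrand x y t.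
Proof.
move=> /andP[t0 t1]; rewrite /beta_integrand mulr_gt0// powR_gt0//.
by rewrite subr_gt0.
Qed.

Lemma powR_le1 x t : 0 < x -> 0 < t <= 1 -> t `^ x <= 1.
Proof. by move=> x0 t1; rewrite -(powRr0 t) ger_powR// ltW. Qed.

Lemma powRB1 x t : 0 < t -> t `^ (x - 1) = t `^ x / t.
Proof.
move=> t0; rewrite powRB ?powRr1 ?ltW//.
by rewrite (gt_eqF t0) implybT.
Qed.

(* Multiply [t^x (1-t)^y <= 1] by [1/(t(1-t)) = 1/t + 1/(1-t)]. *)
Lemma beta_integrand_le x y t : 0 < x -> 0 < y -> 0 < t < 1 ->
  beta_integrand x y t <= t `^ (x - 1) + (1 - t) `^ (y - 1).
Proof.
move=> x0 y0 /andP[t0 t1]; have s0 : 0 < 1 - t by rewrite subr_gt0.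
have tx : t `^ x <= 1 by apply: powR_le1 => //; rewrite t0 ltW.
have sy : (1 - t) `^ y <= 1.
  by apply: powR_le1 => //; rewrite s0 gerBl ltW.
rewrite /beta_integrand !powRB1//.
have -> : t `^ x / t * ((1 - t) `^ y / (1 - t)) =
    t `^ x / t * (1 - t) `^ y + (1 - t) `^ y / (1 - t) * t `^ x.
  by field; rewrite !gt_eqF.
by apply: lerD; rewrite ler_piMr// divr_ge0 ?powR_ge0// ltW.
Qed.

(** The dominating sum [h] has the explicit primitive [H], whose increments over the inner intervals
    are at most 1/x + 1/y. *)
Lemma integrable_beta_integrand x y : 0 < x -> 0 < y ->
  mu.-integrable `]0%R, 1%R[ (EFin \o beta_integrand x y).
Proof.
move=> x0 y0; pose h t := t `^ (x - 1) + (1 - t) `^ (y - 1).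
pose H t := t `^ x / x - (1 - t) `^ y / y.
have h0 t : 0 <= h t by rewrite addr_ge0 ?powR_ge0.
have dH t : 0 < t < 1 -> is_derive t 1 H (h t).
  move=> /andP[t0 t1].
  have d1 := @is_deriveM _ _ (@powR R ^~ x) (cst x^-1) t 1 _ _
    (is_derive1_powR x t0) (is_derive_cst _ _ _).
  have d2 := @is_deriveM _ _ (fun t => (1 - t) `^ y) (cst y^-1) t 1 _ _
    (is_derive_powR_onem y t1) (is_derive_cst _ _ _).
  apply: (is_derive_eq (is_deriveB d1 d2)).
  by rewrite /h /= /GRing.scale /=; field; rewrite !gt_eqF.
have ch t : 0 < t < 1 -> {for t, continuous h}.
  move=> /andP[t0 t1]; apply: continuousD.
    apply: differentiable_continuous; apply/derivable1_diffP.
    exact: (@ex_derive _ _ _ _ _ _ _ (is_derive1_powR (x - 1) t0)).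
  apply: differentiable_continuous; apply/derivable1_diffP.
  exact: (@ex_derive _ _ _ _ _ _ _ (is_derive_powR_onem (y - 1) t1)).
have mh : measurable_fun setT h.
  apply: measurable_funD; first exact: measurable_powR.
  apply: (@measurableT_comp _ _ _ _ _ _ (@powR R ^~ (y - 1))).
    exact: measurable_powR.
  exact: measurable_funB.
have ih : mu.-integrable `]0%R, 1%R[ (EFin \o h).
  apply/integrableP; split.
    by apply/measurable_EFinP; exact: measurable_funTS.
  under eq_integral do rewrite /= ger0_norm ?h0//.
  apply: (@le_lt_trans _ _ (x^-1 + y^-1)%:E); last exact: ltry.
  have cv := cvg_integral_inner_itv mh (fun t _ => h0 t).
  rewrite -(cvg_lim _ cv)//; apply: lime_le.
    by apply/cvg_ex; eexists; exact: cv.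
  apply: nearW => n; rewrite (integral_inner_itv n dH ch) lee_fin /H.
  have [e0 e1] := @inner_itv_ends R n.
  set e := _^-1 in e0 e1 *.
  have xx : 0 < x^-1 by rewrite invr_gt0.
  have yy : 0 < y^-1 by rewrite invr_gt0.
  have a1 : (1 - e) `^ x / x <= x^-1.
    apply: ler_piMl (ltW _) (powR_le1 _ _) => //.
    by apply/andP; split; lra.
  have a2 : (1 - e) `^ y / y <= y^-1.
    apply: ler_piMl (ltW _) (powR_le1 _ _) => //.
    by apply/andP; split; lra.
  have a3 : 0 <= e `^ x / x by rewrite divr_ge0 ?powR_ge0 ?ltW.
  have a4 : 0 <= (1 - (1 - e)) `^ y / y by rewrite divr_ge0 ?powR_ge0 ?ltW.
  lra.
apply: (le_integrable _ _ _ ih); first exact: measurable_itv.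
  by apply/measurable_EFinP; apply: measurable_funTS;
    exact: measurable_beta_integrand.
move=> t /=; rewrite in_itv /= => t01.
rewrite lee_fin !ger0_norm ?h0 ?(ltW (beta_integrand_gt0 _ _ t01))//.
exact: beta_integrand_le.
Qed.

End BetaIntegrand.

(** * Recurrences and positivity of the beta function *)

Section EulerBeta.
Variable R : realType.
Implicit Types x y t : R.

Local Notation mu := (@lebesgue_measure R).

Lemma cvg_Rintegral_inner_itv (f : R -> R) :
    mu.-integrable `]0%R, 1%R[ (EFin \o f) -> measurable_fun setT f ->
    (forall t, 0 < t < 1 -> 0 <= f t) ->
  \int[mu]_(t in inner_itv n) f t @[n --> \oo] -->
  \int[mu]_(t in `]0%R, 1%R[) f t.
Proof.
move=> intf mf f0; rewrite /Rintegral; apply: fine_cvg.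
rewrite fineK; first exact: cvg_integral_inner_itv.
by apply: integrable_fin_num intf; exact: measurable_itv.
Qed.

Lemma cvg_inner_itv_end_powR x : 0 < x ->
  (n.+3%:R^-1 : R) `^ x @[n --> \oo] --> 0.
Proof.
move=> x0; apply: (iffLR (cvg_at_rightP _ _ _) (powR_cvg0 x0)); split.
  by move=> n; rewrite invr_gt0 ltr0n.
(* The harmonic sequence is 1/(n+1); a shift by 2 turns it into the left ends 1/(n+3). *)
have := @cvg_harmonic R; rewrite -(@cvg_shiftn 2).
by under eq_fun do rewrite /harmonic addn2.
Qed.

(** Integration by parts: t^x (1-t)^y vanishes at 0 and 1, so its derivative [f] has integral 0. The
    integrals of [f] over the inner intervals are computed in two ways, by linearity and by boundary
    values, and the limits compared. *)
Lemma mul_euler_betaS x y : 0 < x -> 0 < y ->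
  x * euler_beta x (y + 1) = y * euler_beta (x + 1) y.
Proof.
move=> x0 y0.
have x1 : 0 < x + 1 by lra.
have y1 : 0 < y + 1 by lra.
pose F t := t `^ x * (1 - t) `^ y.
pose f t := x * beta_integrand x (y + 1) t - y * beta_integrand (x + 1) y t.
have dF t : 0 < t < 1 -> is_derive t 1 F (f t).
  by rewrite /f /beta_integrand !addrK; exact: is_derive_beta_primitive.
have cf t : 0 < t < 1 -> {for t, continuous f}.
  move=> t01.
  have cg k u v : {for t, continuous (fun s => k * beta_integrand u v s)}.
    by apply: cvgMr; exact: continuous_beta_integrand.
  by apply: continuousB; exact: cg.
have ib := integrable_beta_integrand.
have iS n u v : 0 < u -> 0 < v ->
    mu.-integrable (inner_itv n) (EFin \o beta_integrand u v).
  move=> u0 v0; apply: integrableS (ib _ _ _ u0 v0) => //.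
  - exact: measurable_inner_itv.
  - by move=> t /inner_itvW; rewrite /= in_itv.
have cvI u v : 0 < u -> 0 < v ->
    \int[mu]_(t in inner_itv n) beta_integrand u v t @[n --> \oo] -->
    euler_beta u v.
  move=> u0 v0; apply: cvg_Rintegral_inner_itv.
  - exact: ib.
  - exact: measurable_beta_integrand.
  - by move=> t t01; exact: ltW (beta_integrand_gt0 _ _ t01).
have E n : \int[mu]_(t in inner_itv n) f t =
    x * \int[mu]_(t in inner_itv n) beta_integrand x (y + 1) t -
    y * \int[mu]_(t in inner_itv n) beta_integrand (x + 1) y t.
  have mS := @measurable_inner_itv R n.
  rewrite -!RintegralZl ?RintegralB//; try exact: iS;
    exact: integrableZl (iS _ _ _ _ _).
have c1 : \int[mu]_(t in inner_itv n) f t @[n --> \oo] -->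
    x * euler_beta x (y + 1) - y * euler_beta (x + 1) y.
  under eq_fun do rewrite E.
  by apply: cvgB; apply: cvgMr; exact: cvI.
have c2 : \int[mu]_(t in inner_itv n) f t @[n --> \oo] --> (0 : R).
  have cx := cvg_inner_itv_end_powR x0; have cy := cvg_inner_itv_end_powR y0.
  have cNx : - (n.+3%:R^-1 : R) `^ x @[n --> \oo] --> 0.
    by rewrite -oppr0; apply: cvgN.
  (* With e = 1/(n+3), the boundary term (1-e)^x e^y - e^x (1-e)^y lies between -e^x and e^y. *)
  apply: squeeze_cvgr cNx cy; apply: nearW => n.
  rewrite /Rintegral (integral_inner_itv n dF cf) /= /F.
  have [e0 e1] := @inner_itv_ends R n; set e := _^-1 in e0 e1 *.
  have ex := @powR_le1 R x (1 - e) x0; have ey := @powR_le1 R y (1 - e) y0.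
  have -> : 1 - (1 - e) = e by ring.
  have h1 : (1 - e) `^ x * e `^ y <= e `^ y.
    by apply: ler_piMl; [exact: powR_ge0|apply: ex; apply/andP; split; lra].
  have h2 : e `^ x * (1 - e) `^ y <= e `^ x.
    by apply: ler_piMr; [exact: powR_ge0|apply: ey; apply/andP; split; lra].
  have h3 : 0 <= (1 - e) `^ x * e `^ y by rewrite mulr_ge0 ?powR_ge0.
  have h4 : 0 <= e `^ x * (1 - e) `^ y by rewrite mulr_ge0 ?powR_ge0.
  by apply/andP; split; lra.
apply/eqP; rewrite -subr_eq0; apply/eqP; exact: cvg_unique c1 c2.
Qed.

(** Insert the factor t + (1-t) = 1 into the integrand. *)
Lemma euler_betaD1 x y : 0 < x -> 0 < y ->
  euler_beta x y = euler_beta (x + 1) y + euler_beta x (y + 1).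
Proof.
move=> x0 y0; rewrite /euler_beta -RintegralD//=.
- apply: eq_Rintegral => t; rewrite inE /= in_itv /= => /andP[t0 t1].
  have s0 : 0 < 1 - t by rewrite subr_gt0.
  by rewrite !addrK !powRB1//; field; rewrite !gt_eqF.
- by apply: integrable_beta_integrand => //; lra.
- by apply: integrable_beta_integrand => //; lra.
Qed.

Lemma euler_beta_recl x y : 0 < x -> 0 < y ->
  x * euler_beta x y = (x + y) * euler_beta (x + 1) y.
Proof.
by move=> x0 y0; rewrite euler_betaD1// mulrDr mul_euler_betaS// mulrDl.
Qed.

(** On the middle third the integrand is at least the positive constant [c]. *)
Lemma euler_beta_gt0 x y : 0 < x -> 0 < y -> 0 < euler_beta x y.
Proof.
move=> x0 y0; have ib := integrable_beta_integrand x0 y0.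
have mI : measurable (`]0%R, 1%R[ : set (measurableTypeR R)).
  exact: measurable_itv.
pose c : R := 3%:R^-1 `^ x * 3%:R^-1 `^ y.
have e0 : 0 < 3%:R^-1 :> R by rewrite invr_gt0 ltr0n.
have c0 : 0 < c by rewrite mulr_gt0// powR_gt0.
rewrite -lte_fin /euler_beta /Rintegral fineK; last exact: integrable_fin_num.
apply: (@lt_le_trans _ _ (\int[mu]_(t in inner_itv 0) c%:E)%E).
  rewrite integral_cst; last exact: measurable_inner_itv.
  rewrite mule_gt0 ?lte_fin// /inner_itv /= lebesgue_measure_itv /= lte_fin.
  rewrite ifT; last by lra.
  by rewrite -EFinB lte_fin; lra.
have mb : measurable_fun (`]0%R, 1%R[ : set (measurableTypeR R))
    (fun t => (t `^ (x - 1) * (1 - t) `^ (y - 1))%:E).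
  by apply/measurable_EFinP; apply: measurable_funTS;
    exact: measurable_beta_integrand.
apply: (@le_trans _ _ (\int[mu]_(t in inner_itv 0)
    (t `^ (x - 1) * (1 - t) `^ (y - 1))%:E)%E); last first.
  apply: ge0_subset_integral => //.
  - exact: measurable_inner_itv.
  - by move=> t _; rewrite lee_fin mulr_ge0 ?powR_ge0.
  - by move=> t /inner_itvW; rewrite /= in_itv.
apply: ge0_le_integral => //.
- exact: measurable_inner_itv.
- by move=> t _; rewrite lee_fin mulr_ge0 ?powR_ge0.
- by apply: measurable_funS mb => // t /inner_itvW; rewrite /= in_itv.
move=> t ht; have /andP[t0 t1] := inner_itvW ht.
move: ht; rewrite /inner_itv /= in_itv /= => /andP[h1 h2].
have s0 : 0 < 1 - t by lra.
(* The exponent [z - 1] may be negative, so the bound passes through s^z, which increases in s and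
   is at most s^(z-1) for s < 1. *)
have le (z s : R) : 0 < z -> 3%:R^-1 <= s -> s < 1 ->
    3%:R^-1 `^ z <= s `^ (z - 1).
  move=> z0 s3 s1; have sp : 0 < s by apply: lt_le_trans s3.
  apply: (@le_trans _ _ (s `^ z)).
    by apply: ge0_ler_powR => //; rewrite ?nnegrE; exact: ltW.
  by rewrite ger_powR ?gerBl// sp ltW.
rewrite lee_fin ler_pM ?powR_ge0 ?le//; lra.
Qed.

End EulerBeta.

(** * Log-convexity in the first argument and its integration over [a, b] *)

Section BetaRatio.
Variable R : realType.
Implicit Types a b c h s t u x y : R.

Local Notation mu := (@lebesgue_measure R).

(** Bernoulli's inequality for real exponents, from u^h >= 1 + h ln u and u ln u >= u - 1, both
    instances of exp v >= 1 + v. *)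
Lemma powR_ge_tangent1 u h : 0 < u -> 0 <= h ->
  1 + (1 + h) * (u - 1) <= u `^ (1 + h).
Proof.
move=> u0 h0; have un0 : u != 0 by rewrite gt_eqF.
rewrite powRD ?un0 ?implybT// (powRr1 (ltW u0)).
have p1 : 1 + h * ln u <= u `^ h.
  by rewrite /powR (negbTE un0) expR_ge1Dx.
have p2 : 1 - ln u <= u^-1.
  by have := expR_ge1Dx (- ln u); rewrite expRN lnK ?posrE.
have p3 : u * (1 + h * ln u) <= u * u `^ h by rewrite ler_pM2l.
have p4 : h * (u * (1 - ln u)) <= h * (u * u^-1).
  by rewrite ler_wpM2l// ler_pM2l.
rewrite divff// in p4.
lra.
Qed.

(* Log-convexity of [B(., y)]: integrate the tangent line of [t^(1+h)] at
   [t = l], where [l = B(s+1,y)/B(s,y)], against the density of [B(s,y)]. *)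
Lemma euler_beta_shift_ge s h y : 0 < s -> 0 <= h -> 0 < y ->
  (s / (s + y)) `^ h * euler_beta (s + 1) y <= euler_beta (s + 1 + h) y.
Proof.
move=> s0 h0 y0; set l := s / (s + y).
have sy0 : 0 < s + y by lra.
have s1 : 0 < s + 1 by lra.
have sh : 0 < s + 1 + h by lra.
have l0 : 0 < l by rewrite divr_gt0.
have lB : l * euler_beta s y = euler_beta (s + 1) y.
  by rewrite /l mulrAC euler_beta_recl// mulrAC divff ?mul1r// gt_eqF.
have mI : measurable (`]0%R, 1%R[ : set (measurableTypeR R)).
  exact: measurable_itv.
have i0 := integrable_beta_integrand s0 y0.
have i1 := integrable_beta_integrand s1 y0.
have ih := integrable_beta_integrand sh y0.
(* The tangent line of t^(1+h) at [l] is p t - q. *)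
pose p := l `^ h * (1 + h); pose q := l `^ h * (h * l).
have ip : mu.-integrable `]0%R, 1%R[
    (EFin \o (fun t => p * beta_integrand (s + 1) y t)).
  exact: integrableZl i1.
have iq : mu.-integrable `]0%R, 1%R[
    (EFin \o (fun t => q * beta_integrand s y t)).
  exact: integrableZl i0.
have E : l `^ h * euler_beta (s + 1) y =
    \int[mu]_(t in `]0%R, 1%R[)
      (p * beta_integrand (s + 1) y t - q * beta_integrand s y t).
  rewrite RintegralB// !RintegralZl//.
  rewrite -/(euler_beta s y) -/(euler_beta (s + 1) y) -lB /p /q; ring.
rewrite E -[leRHS]/(\int[mu]_(t in `]0%R, 1%R[) beta_integrand (s + 1 + h) y t).
apply: le_Rintegral => //.
  exact: (integrableB mI ip iq).
move=> t; rewrite /= in_itv /= => /andP[t0 t1].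
have tn0 : t != 0 by rewrite gt_eqF.
have ln0 : l != 0 by rewrite gt_eqF.
have -> : beta_integrand (s + 1 + h) y t = t `^ (1 + h) * beta_integrand s y t.
  rewrite /beta_integrand mulrA -powRD ?tn0 ?implybT//.
  by congr (_ `^ _ * _); ring.
have -> : beta_integrand (s + 1) y t = t * beta_integrand s y t.
  by rewrite /beta_integrand addrK (powRB1 _ t0); field.
rewrite mulrA -mulrBl ler_pM2r; last by apply: beta_integrand_gt0; rewrite t0.
have tl : 0 < t / l by rewrite divr_gt0.
(* Scaling by [l] moves the point of tangency to 1. *)
have -> : t = l * (t / l) by rewrite mulrCA divff// mulr1.
have := powR_ge_tangent1 tl h0.
set u := t / l => tg.
rewrite (powRM _ (ltW l0) (ltW tl)) [l `^ (1 + h)]powRD ?ln0 ?implybT//.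
rewrite (powRr1 (ltW l0)).
have -> : p * (l * u) - q = l * l `^ h * (1 + (1 + h) * (u - 1)).
  by rewrite /p /q; ring.
by rewrite ler_pM2l// mulr_gt0// powR_gt0.
Qed.

(** Cut [a, b] into N equal steps: the errors add up to K (b-a)^2 / N, which tends to 0. This stands
    in for an argument by a nonnegative derivative. *)
Lemma le_of_quadratic_error (D : R -> R) (K a b : R) : a <= b ->
  (forall s h, a <= s -> 0 <= h -> s + h <= b ->
     D s - K * h ^+ 2 <= D (s + h)) ->
  D a <= D b.
Proof.
move=> ab HD.
have step n k : (k <= n.+1)%N ->
    D a - k%:R * (K * ((b - a) / n.+1%:R) ^+ 2) <=
    D (a + k%:R * ((b - a) / n.+1%:R)).
  set h := (b - a) / n.+1%:R.
  have h0 : 0 <= h by rewrite divr_ge0// subr_ge0.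
  elim: k => [_|k IH kn]; first by rewrite !mul0r subr0 addr0.
  have h1 : 0 <= k%:R * h by rewrite mulr_ge0.
  have h2 : k.+1%:R * h <= b - a.
    rewrite /h mulrCA ler_piMr ?subr_ge0// ler_pdivrMr ?ltr0n//.
    by rewrite mul1r ler_nat.
  have h3 : a + k%:R * h + h = a + k.+1%:R * h by rewrite -natr1; ring.
  have := HD (a + k%:R * h) h; rewrite h3 lerDl -lerBrDl => /(_ h1 h0 h2).
  have := IH (ltnW kn).
  have -> : k.+1%:R * (K * h ^+ 2) = k%:R * (K * h ^+ 2) + K * h ^+ 2.
    by rewrite -natr1 mulrDl mul1r.
  lra.
rewrite leNgt; apply/negP => ba.
pose e := D a - D b; have e0 : 0 < e by rewrite subr_gt0.
(* Enough steps for the total error to fall below the supposed drop [e]; the absolute value makes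
   the Archimedean bound apply for either sign of [K]. *)
pose n := Num.Def.archi_bound (`|K| * (b - a) ^+ 2 / e).
have hn : `|K| * (b - a) ^+ 2 / e < n.+1%:R.
  apply: lt_le_trans (archi_boundP _) _; last by rewrite ler_nat.
  exact: divr_ge0 (mulr_ge0 (normr_ge0 _) (sqr_ge0 _)) (ltW e0).
have := step n n.+1 (leqnn _).
have n0 : n.+1%:R != 0 :> R by rewrite pnatr_eq0.
have -> : a + n.+1%:R * ((b - a) / n.+1%:R) = b by field.
have -> : n.+1%:R * (K * ((b - a) / n.+1%:R) ^+ 2) = K * (b - a) ^+ 2 / n.+1%:R.
  by field.
apply/negP; rewrite -ltNge.
rewrite ltrBrDl -ltrBrDr -/e.
rewrite ltr_pdivrMr ?ltr0n// -ltr_pdivrMl// [e^-1 * _]mulrC.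
apply: le_lt_trans hn; rewrite ler_pM2r ?invr_gt0//.
by rewrite ler_wpM2r ?sqr_ge0// ler_norm.
Qed.

Lemma ln_le_subr1 u : 0 < u -> ln u <= u - 1.
Proof.
by move=> u0; rewrite -{1}(subrK 1 u) addrC le_ln1Dx// ltrBrDr addNr.
Qed.

(* In the limit [h -> 0] the hypothesis reads [G' >= ln (s / (s + y))], and by
   concavity of [ln] the right-hand side is at least [1 + ln c - c (s + y) / s],
   whose integral over [a, b] is the claimed bound. *)
Lemma increment_ge_ln_ratio (G : R -> R) a b y c :
    0 < a -> a <= b -> 0 < y -> 0 < c ->
    (forall s h, 0 < s -> 0 <= h -> h * ln (s / (s + y)) <= G (s + h) - G s) ->
  (ln c + 1 - c) * (b - a) - c * y * ln (b / a) <= G b - G a.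
Proof.
move=> a0 ab y0 c0 HG; have b0 : 0 < b by lra.
(* [D] is [G] minus a primitive of 1 + ln c - c (s + y) / s. *)
pose D s := G s - (ln c + 1 - c) * s + c * y * ln s.
suff : D a <= D b by rewrite /D ln_div ?posrE//; lra.
(* The quadratic error comes from ln (s+h) - ln s >= h/(s+h) = h/s - h^2/(s(s+h)), where s(s+h) >=
   a^2. *)
apply: (@le_of_quadratic_error D (c * y / a ^+ 2)) => // s h as_ h0 shb.
have s0 : 0 < s by lra.
have sh0 : 0 < s + h by lra.
have sy0 : 0 < s + y by lra.
have sN : s != 0 by rewrite gt_eqF.
have aN : a != 0 by rewrite gt_eqF.
have shN : s + h != 0 by rewrite gt_eqF.
have H1 := HG s h s0 h0.
have H2 : ln c + 1 - c - c * y / s <= ln (s / (s + y)).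
  have u0 : 0 < c * ((s + y) / s) by rewrite mulr_gt0// divr_gt0.
  have := ln_le_subr1 u0.
  rewrite lnM ?posrE ?divr_gt0// !ln_div ?posrE//.
  have -> : c * ((s + y) / s) = c + c * y / s by field.
  lra.
have H3 : h * (ln c + 1 - c - c * y / s) <= h * ln (s / (s + y)).
  by rewrite ler_wpM2l.
have H4 : h / (s + h) <= ln (s + h) - ln s.
  have v0 : 0 < s / (s + h) by rewrite divr_gt0.
  have := ln_le_subr1 v0; rewrite ln_div ?posrE//.
  have -> : s / (s + h) = 1 - h / (s + h) by field.
  lra.
have H5 : h / s - h ^+ 2 / a ^+ 2 <= h / (s + h).
  have -> : h / (s + h) = h / s - h ^+ 2 / (s * (s + h)).
    by field; rewrite ?sN ?shN.
  rewrite lerD2l lerN2 ler_wpM2l ?sqr_ge0// lef_pV2 ?posrE ?mulr_gt0//.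
  by rewrite expr2 ler_pM ?(ltW a0)//; lra.
have H6 : c * y * (h / s - h ^+ 2 / a ^+ 2) <= c * y * (ln (s + h) - ln s).
  rewrite ler_wpM2l ?(le_trans H5 H4)//.
  by rewrite mulr_ge0 ?ltW.
rewrite /D; lra.
Qed.

(** Logarithm of [euler_beta_shift_ge], in the form [increment_ge_ln_ratio] requires of G(s) = ln
    B(s+1,y). *)
Lemma ln_euler_beta_shift_ge s h y : 0 < s -> 0 <= h -> 0 < y ->
  h * ln (s / (s + y)) <=
  ln (euler_beta (s + h + 1) y) - ln (euler_beta (s + 1) y).
Proof.
move=> s0 h0 y0; have sy0 : 0 < s + y by lra.
have s1 : 0 < s + 1 by lra.
have sh1 : 0 < s + h + 1 by lra.
have l0 : 0 < s / (s + y) by rewrite divr_gt0.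
have := euler_beta_shift_ge s0 h0 y0; rewrite (addrAC s 1 h).
have := euler_beta_gt0 s1 y0; have := euler_beta_gt0 sh1 y0.
move: (euler_beta (s + 1) y) (euler_beta (s + h + 1) y) => A B B0 A0 AB.
rewrite lerBrDr -ln_powR -lnM ?posrE ?powR_gt0//.
by rewrite ler_ln ?posrE ?mulr_gt0 ?powR_gt0.
Qed.

End BetaRatio.

(** * The lower bound for B(b,y)/B(a,y) *)

Theorem theorem2p14 (R : realType) (a b y : R)
    (ha : 0 < a) (hab : a < b) (hy : 0 < y) :
  let c := (b - a) / (b - a + y * ln (b / a)) in
  let alpha := ln c + 1 in
  let beta := - c in
  euler_beta b y / euler_beta a y >=
  expR ((alpha + beta) * (b - a)) * (b / a) `^ (y * beta - 1) *
  ((b + y) / (a + y)).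
Proof.
cbv zeta; set c := (b - a) / _; have b0 : 0 < b by lra.
have L0 : 0 < ln (b / a) by rewrite ln_gt0// ltr_pdivlMr// mul1r.
have d0 : 0 < b - a + y * ln (b / a).
  by have := mulr_gt0 hy L0; lra.
have c0 : 0 < c by rewrite divr_gt0// subr_gt0.
have a1 : 0 < a + 1 by lra.
have b1 : 0 < b + 1 by lra.
have ay : 0 < a + y by lra.
have by_ : 0 < b + y by lra.
have r0 : 0 < b / a by rewrite divr_gt0.
have Ba1 := euler_beta_gt0 a1 hy; have Bb1 := euler_beta_gt0 b1 hy.
have E x : 0 < x -> euler_beta x y = (x + y) / x * euler_beta (x + 1) y.
  by move=> x0; rewrite mulrAC -euler_beta_recl// mulrAC divff ?mul1r ?gt_eqF.
have := increment_ge_ln_ratio ha (ltW hab) hy c0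
  (fun s h s0 h0 => ln_euler_beta_shift_ge s0 h0 hy).
(* The recurrence passes to B(a+1,y) and B(b+1,y), at the cost of the factor (b/a)^-1
   (b+y)/(a+y). *)
rewrite (E a)// (E b)//.
move: (euler_beta (a + 1) y) (euler_beta (b + 1) y) Ba1 Bb1 => A B A0 B0 H.
have -> : (b + y) / b * B / ((a + y) / a * A) =
    B / A * ((b / a)^-1 * ((b + y) / (a + y))).
  by field; rewrite !gt_eqF.
have w0 : 0 < (b + y) / (a + y) by rewrite divr_gt0.
set w := (b + y) / (a + y) in w0 *.
(* The -1 in the exponent of b/a and the last factor [w] cancel exactly what the recurrence
   produced; the logarithm of the rest is the bound in [H]. *)
rewrite powRB1// (mulrA (expR _)) -(mulrA _ _ w) ler_pM2r; last first.
  by rewrite mulr_gt0 ?invr_gt0.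
rewrite -ler_ln ?posrE ?mulr_gt0 ?expR_gt0 ?powR_gt0 ?invr_gt0//.
rewrite lnM ?posrE ?expR_gt0 ?powR_gt0// expRK ln_powR (ln_div B0 A0).
by apply: le_trans H; lra.
Qed.
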